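(* Consider problem instances with $m$ resources of arbitrary delays and $n$ tasks whose weights, indexed so that $w_1\ge w_2\ge\dots\ge w_n$, satisfy $w_1/w_n\le\alpha$ for some pre-set limit $\alpha$. Let $\epsilon\le 1$ be the desired accuracy ($\epsilon>0$). Choose $k$ such that $(w_1/w_n)^{1/k}\le 1+\epsilon$, and round each weight up to the nearest value of the form $w_n\cdot(w_1/w_n)^{t/k}$, where $t$ is as small as possible in $\{0,\dots,k\}$. The new weights take $k+1$ distinct values, and an optimal assignment for the new weights has cost at most $1+\epsilon$ times the cost of an optimal assignment for the old weights. Computing an optimal assignment for the rounded weights by dynamic programming thus gives an approximation scheme. In this case of a fixed bound on the ratio of largest to smallest task weight, $k$ depends only on $\epsilon$, and the resulting algorithm has run time $O(mn^{2k})$, where $k=O(\epsilon^{-1}\ln(w_1/w_n))$.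
   Context: A problem instance $(T,R)$ consists of a set $R=\{1,\dots,m\}$ of resources with delays $d_1\le\dots\le d_m$ (positive reals) and a set $T=\{1,\dots,n\}$ of tasks with real weights $w_1,\dots,w_n\ge 1$. An assignment is a vector $A=(A_1,\dots,A_n)\in\{1,\dots,m\}^n$ (task $i$ is assigned to resource $A_i$). The load of resource $\ell$ in $A$ is $L(\ell,A)=d_\ell\sum_{i\in T:\,A_i=\ell}w_i$, and the (social) cost of $A$ is $C(A)=\sum_{i\in T}L(A_i,A)$. An optimal assignment is one minimizing $C$ over all assignments. The dynamic programming algorithm referred to handles weights taking a bounded number of distinct values $w'_1,\dots,w'_a$: it tabulates the optimal cost $C_{q,j_1,\dots,j_a}$ of assigning $j_\ell$ tasks of weight $w'_\ell$ ($\ell=1,\dots,a$) to the resources with delays $d_1,\dots,d_q$, computing each entry by minimizing over the numbers $j'_1,\dots,j'_a$ of tasks of each weight placed on resource $q$.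
   Formalization: With k+1 distinct weights the described dynamic program needs order m n^(2(k+1)) steps, so that bound replaces O(mn^(2k)) for it; O(mn^(2k)) is proved for a variant minimizing over fewer vectors, for a suitable k = O(1 + ε^(-1) ln α). *)

(* Defs.v *)
From HB Require Import structures.
From mathcomp Require Import all_boot all_order all_algebra.
From mathcomp Require Import all_classical all_reals all_analysis.

Set Implicit Arguments.
Unset Strict Implicit.
Unset Printing Implicit Defensive.

Import Order.TTheory GRing.Theory Num.Theory.
Local Open Scope ring_scope.

(* MathComp-Analysis, over an arbitrary [R : realType].

   An instance has m.+1 resources and n.+1 tasks, so that the largest weight
   w_1 is [w ord0] and the smallest weight w_n is [w ord_max]. *)

Section Model.
Variables (R : realType) (m n : nat).
Implicit Types (d : 'I_m.+1 -> R) (w : 'I_n.+1 -> R).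

Definition assignment := {ffun 'I_n.+1 -> 'I_m.+1}.

Definition load d w (l : 'I_m.+1) (A : assignment) : R :=
  d l * \sum_(i | A i == l) w i.

Definition cost d w (A : assignment) : R := \sum_i load d w (A i) A.

Definition optimal d w (A : assignment) : Prop :=
  forall B : assignment, cost d w A <= cost d w B.

Definition problem_instance d w : Prop :=
  [/\ forall l, 0 < d l,
      forall l l' : 'I_m.+1, (l <= l')%N -> d l <= d l',
      forall i, 1 <= w i
    & forall i i' : 'I_n.+1, (i <= i')%N -> w i' <= w i].

End Model.

Section Rounding.
Variables (R : realType) (n : nat).
Implicit Types (w : 'I_n.+1 -> R) (k : nat).

Definition weight_ratio w : R := w ord0 / w ord_max.

Definition grid w k (t : nat) : R :=
  w ord_max * weight_ratio w `^ (t%:R / k%:R).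

(* The least t in {0, ..., k} with w i <= grid w k t (k.+1 if there is none). *)
Definition level w k (i : 'I_n.+1) : nat :=
  find (fun t => w i <= grid w k t) (iota 0 k.+1).

Definition rounded w k (i : 'I_n.+1) : R := grid w k (level w k i).

End Rounding.

(* Programs carry the number of unit-cost (real RAM) steps they perform:
   real and integer operations, comparisons, array accesses and loop
   iterations cost 1; an operation on an index vector (j_0, ..., j_k) costs
   its length. *)

Definition timed (T : Type) : Type := (T * nat)%type.

Definition result T (p : timed T) : T := p.1.
Definition steps T (p : timed T) : nat := p.2.

Definition charge T (c : nat) (x : T) : timed T := (x, c).

Definition bind S T (p : timed S) (f : S -> timed T) : timed T :=
  let: (x, a) := p in let: (y, b) := f x in (y, (a + b)%N).

Notation "'let!' x := p 'in' q" := (bind p (fun x => q))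
  (at level 200, x name, p at level 100, q at level 200, right associativity).

Fixpoint loop I S (body : S -> I -> timed S) (s : seq I) (acc : S) : timed S :=
  if s is i :: s' then
    let! acc1 := body acc i in
    let! acc2 := charge 1 acc1 in
    loop body s' acc2
  else charge 0 acc.

(* Arrays are functions from indices to contents; [c] is the length of the
   index. *)
Definition read I T (c : nat) (a : I -> T) (i : I) : timed T := charge c (a i).

Definition write (I : eqType) T (c : nat) (a : I -> T) (i : I) (x : T) :
    timed (I -> T) :=
  charge c (fun i' => if i' == i then x else a i').

(* The vectors v with v_t <= N_t for all t. *)
Fixpoint all_vectors (N : seq nat) : seq (seq nat) :=
  if N is b :: N' then [seq x :: v | x <- iota 0 b.+1, v <- all_vectors N']
  else [:: [::]].

(* The vectors v <= j in which v_u = j_u strictly between two positions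
   s <= t and v_u = 0 outside of [s, t].  For fixed numbers n_l of tasks on the
   resources, the cost is the sum of the (d_l n_l) * (weight on l), so by
   rearrangement some optimal assignment gives each resource a block of
   consecutive tasks in the order of weights; hence one resource can always be
   given such a vector. *)
Definition block (j : seq nat) (s t x y : nat) : seq nat :=
  mkseq (fun u => if u == s then x else if u == t then y
                  else if (s < u < t)%N then nth 0%N j u else 0%N) (size j).

Definition block_vectors (j : seq nat) : seq (seq nat) :=
  flatten [seq [seq block j s t x y | x <- iota 0 (nth 0%N j s).+1,
                                      y <- iota 0 (nth 0%N j t).+1]
          | s <- iota 0 (size j), t <- iota s (size j - s)].

Definition vsub (j v : seq nat) : timed (seq nat) :=
  charge (size j) [seq (p.1 - p.2)%N | p <- zip j v].

Section DynamicProgramming.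
Variables (R : realType) (m : nat).
(* [cands j] lists the vectors tried for the last resource when j is the
   vector of the numbers of tasks to be placed. *)
Variable cands : seq nat -> seq (seq nat).
Variable d : 'I_m.+1 -> R.
(* The distinct weights. *)
Variable V : nat -> R.

(* [tab (q, j)] is the optimal cost of assigning j_t tasks of weight V t, for
   all t, to the resources 0, ..., q, with an optimal choice of the vector of
   tasks placed on resource q. *)
Definition table : Type := (nat * seq nat)%type -> (R * seq nat)%type.

(* The cost incurred on resource q by the vector v of tasks. *)
Definition group_cost (q : nat) (v : seq nat) : timed R :=
  let! s := loop (fun acc t =>
                    charge 5 ((acc.1 + nth 0 v t)%N,
                              acc.2 + (nth 0%N v t)%:R * V t))
                 (iota 0 (size v)) (0%N, 0 : R) in
  charge 3 (d (inord q) * s.1%:R * s.2).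

(* Resource 0 takes all the tasks. *)
Definition first_row (N : seq nat) (tab : table) : timed table :=
  loop (fun tab j =>
          let! j := charge (size j) j in
          let! g := group_cost 0 j in
          write (size j).+1 tab (0%N, j) (g, j))
       (all_vectors N) tab.

(* Starts with the null vector on resource q.+1, then tries [cands j]. *)
Definition entry (q : nat) (j : seq nat) (tab : table) :
    timed (R * seq nat)%type :=
  let! e0 := read (size j).+1 tab (q, j) in
  loop (fun best v =>
          let! v := charge (size v) v in
          let! j' := vsub j v in
          let! e := read (size j').+1 tab (q, j') in
          let! g := group_cost q.+1 v in
          let! c := charge 1 (e.1 + g) in
          charge 1 (if c < best.1 then (c, v) else best))
       (cands j) (e0.1, nseq (size j) 0%N).

Definition next_row (N : seq nat) (q : nat) (tab : table) : timed table :=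
  loop (fun tab j =>
          let! j := charge (size j) j in
          let! e := entry q j tab in
          write (size j).+1 tab (q.+1, j) e)
       (all_vectors N) tab.

Definition fill_table (N : seq nat) : timed table :=
  let! tab := first_row N (fun=> (0, [::])) in
  loop (fun tab q => next_row N q tab) (iota 0 m) tab.

(* The numbers of tasks of each weight placed on each resource, read off the
   table from resource m down to resource 0. *)
Definition traceback (N : seq nat) (tab : table) :
    timed (nat -> seq nat) :=
  let! st := loop (fun st q =>
                     let! e := read (size st.2).+1 tab (q, st.2) in
                     let! alloc := write (size e.2) st.1 q e.2 in
                     let! rest := vsub st.2 e.2 in
                     charge 0 (alloc, rest))
                  (rev (iota 0 m.+1)) (fun=> [::], N) in
  charge 0 st.1.

End DynamicProgramming.

Section Scheme.
Variables (R : realType) (m n : nat).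
Variable cands : seq nat -> seq (seq nat).
Variables (k : nat) (d : 'I_m.+1 -> R) (w : 'I_n.+1 -> R).

Definition grid_values : timed (nat -> R) :=
  loop (fun V t => let! x := charge 4 (grid w k t) in write 1 V t x)
       (iota 0 k.+1) (fun=> 0).

Definition find_level (V : nat -> R) (i : 'I_n.+1) : timed nat :=
  loop (fun l t => charge 3 (if w i <= V t then t else l))
       (rev (iota 0 k.+1)) k.

(* The level of each task, and the number of tasks at each level. *)
Definition levels (V : nat -> R) : timed (('I_n.+1 -> nat) * seq nat)%type :=
  loop (fun st i =>
          let! l := find_level V i in
          let! lev := write 1 st.1 i l in
          charge 1 (lev, incr_nth st.2 l))
       (enum 'I_n.+1) (fun=> 0%N, nseq k.+1 0%N).

(* Each task goes to the first resource with room left at its level. *)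
Definition distribute (lev : 'I_n.+1 -> nat) (alloc : nat -> seq nat) :
    timed (assignment m n) :=
  let! st :=
    loop (fun st i =>
            let! l := read 1 lev i in
            let! q := loop (fun q0 q =>
                              charge 2 (if (0 < nth 0 (st.1 q) l)%N then q
                                        else q0))
                           (rev (iota 0 m.+1)) 0%N in
            let! alloc :=
              write 2 st.1 q (set_nth 0%N (st.1 q) l (nth 0%N (st.1 q) l).-1) in
            let! A := write 1 st.2 i (inord q : 'I_m.+1) in
            charge 0 (alloc, A))
         (enum 'I_n.+1) (alloc, fun=> ord0) in
  charge 0 (finfun st.2).

(* Round the weights with parameter k, then solve the rounded instance. *)
Definition scheme : timed (assignment m n) :=
  let! V := grid_values in
  let! lv := levels V in
  let! tab := fill_table cands d V lv.2 in
  let! alloc := traceback m lv.2 tab in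
  distribute lv.1 alloc.

End Scheme.

Definition full_scheme (R : realType) m n := @scheme R m n all_vectors.
Definition block_scheme (R : realType) m n := @scheme R m n block_vectors.

(* On input (d, w), the algorithm [alg] returns an optimal assignment for the
   rounded weights, which is (1 + eps)-optimal for the given weights. *)
Definition solves (R : realType) m n (alg : timed (assignment m n))
    (eps : R) (k : nat) (d : 'I_m.+1 -> R) (w : 'I_n.+1 -> R) : Prop :=
  optimal d (rounded w k) (result alg) /\
  forall A, optimal d w A -> cost d w (result alg) <= (1 + eps) * cost d w A.

(* Main.v *)
Require Import Defs.
From mathcomp Require Import all_boot all_order all_algebra.
From mathcomp Require Import all_classical all_reals all_analysis.
From mathcomp Require Import zify ring lra.
Import Order.TTheory GRing.Theory Num.Theory.
Local Open Scope ring_scope.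

Set Implicit Arguments.
Unset Strict Implicit.
Unset Printing Implicit Defensive.

(* Only the vector of the numbers of tasks of each level matters for the cost on
   a resource, so the table indexed by such vectors computes the optimum over
   all assignments as soon as the candidates tried for the last resource
   contain, up to a change of the other resources, some optimal choice.  For
   block vectors this holds by exchange: if the last resource holds tasks of
   levels s < t while another resource holds a task of a level u strictly in
   between, then swapping this task with a task of level s or with one of level
   t does not raise the cost, and it brings the last resource closer to a block.

   With ratio^(1/k) <= 1 + eps, rounding to the grid raises every weight by a
   factor at most 1 + eps, hence also the cost of every assignment.  By
   ln (1 + eps) >= eps / 2, any k >= 2 ln alpha / eps is large enough.

   The table has O(m n^(k+1)) entries, since the vectors have k + 1 components;
   an entry takes O(n^(k+1)) time with all vectors and O(n^2) with block
   vectors, whence O(m n^(2(k+1))) and O(m n^(k+3)). *)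

(** * Exchanging tasks between two resources *)

Section Allocations.
Variables (R : realType) (D V : nat -> R) (K : nat).
Implicit Types (a : nat -> nat -> nat) (j : seq nat).

(** [f u] counts tasks of weight [V u] on [l]. Each task there pays the whole load, hence the
    product of delay, number of tasks and total weight. *)
Definition resource_cost (l : nat) (f : nat -> nat) : R :=
  D l * (\sum_(u < K) f u)%:R * \sum_(u < K) (f u)%:R * V u.

Definition alloc_cost (q : nat) a : R := \sum_(l < q.+1) resource_cost l (a l).

Definition allocates (q : nat) a j : Prop :=
  forall u, (u < K)%N -> (\sum_(l < q.+1) a l u)%N = nth 0%N j u.

(** A task of level [s] on [L] trades places with one of level [u] on [l]. The truncated
    subtractions are exact once both tasks exist. *)
Definition exchange a (L l s u : nat) : nat -> nat -> nat := fun r x =>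
  if r == L then (a L x + (x == u) - (x == s))%N
  else if r == l then (a l x + (x == s) - (x == u))%N else a r x.

Lemma eq_resource_cost l f g :
  (forall u, (u < K)%N -> f u = g u) -> resource_cost l f = resource_cost l g.
Proof.
move=> fg; rewrite /resource_cost; congr (_ * _%:R * _).
- by apply: eq_bigr => u _; exact: fg.
- by apply: eq_bigr => u _; rewrite fg.
Qed.

(** The number of tasks on [l] stays the same, so only the total weight varies, by [V u - V s]. *)
Lemma resource_cost_move l f s u : (s < K)%N -> (u < K)%N -> (0 < f s)%N ->
  resource_cost l (fun x => f x + (x == u) - (x == s))%N =
  resource_cost l f + D l * (\sum_(x < K) f x)%:R * (V u - V s).
Proof.
move=> sK uK fs.
have cE (x : 'I_K) :
    (f x + (x == u :> nat) - (x == s :> nat))%N%:R =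
    (f x)%:R + (x == u :> nat)%:R - (x == s :> nat)%:R :> R.
  by rewrite natrB ?natrD//; case: eqP => [->|_]; lia.
have pick (y : nat) (g : nat -> R) : (y < K)%N ->
    \sum_(x < K) (x == y :> nat)%:R * g x = g y.
  move=> yK; rewrite (bigD1 (Ordinal yK))//= eqxx mul1r big1 ?addr0// => x.
  by rewrite -val_eqE/= => /negPf ->; rewrite mul0r.
have pick1 (y : nat) : (y < K)%N -> \sum_(x < K) (x == y :> nat)%:R = 1 :> R.
  by move=> yK; rewrite -[RHS](pick y (fun=> 1))//; apply: eq_bigr => x _;
    rewrite mulr1.
rewrite /resource_cost.
have -> : (\sum_(x < K) (f x + (x == u :> nat) - (x == s :> nat)))%N =
          (\sum_(x < K) f x)%N.
  apply/eqP; rewrite -(eqr_nat R) !natr_sum (eq_bigr _ (fun x _ => cE x)).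
  rewrite sumrB big_split/=.
  by rewrite !pick1// addrK.
rewrite -mulrDr; congr (_ * _).
under eq_bigr do rewrite cE mulrBl mulrDl.
by rewrite sumrB big_split/= !pick// addrA.
Qed.

Section Exchange.
Variables (q L l s u : nat) (a : nat -> nat -> nat).
Hypotheses (Lq : (L < q.+1)%N) (lq : (l < q.+1)%N) (lL : l != L).
Hypotheses (sK : (s < K)%N) (uK : (u < K)%N).
Hypotheses (as0 : (0 < a L s)%N) (au0 : (0 < a l u)%N).

(** Any commutative monoid [T] is allowed, so that the lemma serves both for numbers of tasks and
    for costs. *)
Lemma sum_exchange_resources (T : nmodType) (F : nat -> (nat -> nat) -> T) :
  \sum_(r < q.+1) F r (exchange a L l s u r) =
  F L (exchange a L l s u L) + (F l (exchange a L l s u l) +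
    \sum_(r < q.+1 | (r != Ordinal Lq) && (r != Ordinal lq)) F r (a r)).
Proof.
rewrite (bigD1 (Ordinal Lq))//= (bigD1 (Ordinal lq))//=.
congr (_ + (_ + _)); apply: eq_bigr => r /andP[].
by rewrite -!val_eqE/= => rL rl; rewrite /exchange (negPf rL) (negPf rl).
Qed.

Lemma exchange_allocates j :
  allocates q a j -> allocates q (exchange a L l s u) j.
Proof.
move=> aj x xK; rewrite -(aj x xK).
rewrite (sum_exchange_resources (fun _ f => f x)).
rewrite [RHS](bigD1 (Ordinal Lq))//= [in RHS](bigD1 (Ordinal lq))//=.
rewrite addrA [RHS]addrA; congr (_ + _)%N.
rewrite /exchange eqxx (negPf lL) eqxx.
have [xu|xu] := eqVneq x u; have [xs|xs] := eqVneq x s; subst => //=.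
(* The sum was split in the additive structure of [nat]; unfolding it exposes plain addition to
   [lia]. *)
all: by rewrite /GRing.add/=; lia.
Qed.

Lemma exchange_cost :
  alloc_cost q (exchange a L l s u) = alloc_cost q a +
  (D L * (\sum_(x < K) a L x)%:R - D l * (\sum_(x < K) a l x)%:R) *
  (V u - V s).
Proof.
rewrite /alloc_cost (sum_exchange_resources resource_cost).
rewrite [in RHS](bigD1 (Ordinal Lq))//= [in RHS](bigD1 (Ordinal lq))//=.
rewrite /exchange eqxx (negPf lL) eqxx !resource_cost_move//.
ring.
Qed.

End Exchange.

Lemma alloc_le q a j l u : allocates q a j -> (l < q.+1)%N -> (u < K)%N ->
  (a l u <= nth 0%N j u)%N.
Proof. by move=> aj lq uK; rewrite -aj// (bigD1 (Ordinal lq))//= leq_addr. Qed.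

Hypothesis V_homo : forall s t, (s <= t)%N -> (t < K)%N -> V s <= V t.

(* With p the delay times the number of tasks, swapping a task of level u on l
   with a task of level s or t on L changes the cost by (p_L - p_l) (V u - V s)
   or (p_l - p_L) (V t - V u); one of them is not positive if s < u < t.  The
   induction is on t - s = g, then on the number of tasks of L at s and t. *)
Lemma block_alloc q L j : (L < q.+1)%N -> forall g e s a,
  allocates q a j -> (s + g < K)%N ->
  (forall x, (x < K)%N -> (0 < a L x)%N -> (s <= x <= s + g)%N) ->
  (a L s + a L (s + g) <= e)%N ->
  exists a' s' t', [/\ allocates q a' j, alloc_cost q a' <= alloc_cost q a,
    (s' <= t' < K)%N,
    forall x, (x < K)%N -> (0 < a' L x)%N -> (s' <= x <= t')%N &
    forall x, (s' < x < t')%N -> a' L x = nth 0%N j x].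
Proof.
move=> Lq; elim=> [|g IHg].
  move=> _ s a aj sK supp _; exists a, s, s; split=> //.
  - by rewrite leqnn/= -(addn0 s).
  - by move=> x xK /(supp x xK); rewrite addn0.
  - by move=> x; lia.
(* With [e = 0] there is no task of level [s] on [L], so the range can start at [s.+1]. *)
elim=> [|e IHe] s a aj sK supp le_e.
  apply: (IHg _ s.+1 a aj) (leqnn _); first by lia.
  move=> x xK ax; have := supp x xK ax.
  by have [xs|] := eqVneq x s; [subst; lia|lia].
have [as0|as0] := posnP (a L s).
  apply: (IHg _ s.+1 a aj) (leqnn _); first by lia.
  move=> x xK ax; have := supp x xK ax.
  by have [xs|] := eqVneq x s; [subst; lia|lia].
have [at0|at0] := posnP (a L (s + g.+1)%N).
  apply: (IHg _ s a aj) (leqnn _); first by lia.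
  move=> x xK ax; have := supp x xK ax.
  by have [xs|] := eqVneq x (s + g.+1)%N; [subst; lia|lia].
have [/hasPn full|] :=
    boolP (~~ has (fun x => a L x != nth 0%N j x) (iota s.+1 g)).
  exists a, s, (s + g.+1)%N; split=> //; first by rewrite leq_addr.
  move=> x sxt; apply/eqP; have := full x.
  by rewrite mem_iota negbK; apply; lia.
rewrite negbK => /hasP[u]; rewrite mem_iota => su auj.
have uK : (u < K)%N by lia.
(* [L] does not hold all tasks of level [u], so another resource holds one. *)
have [l [lq lL al]] : exists l, [/\ (l < q.+1)%N, l != L & (0 < a l u)%N].
  have : (a L u < nth 0%N j u)%N.
    by rewrite ltn_neqAle auj; exact: alloc_le aj _ _.
  rewrite -(aj u uK) (bigD1 (Ordinal Lq))//= -[ltnLHS]addn0 ltn_add2l.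
  rewrite lt0n sum_nat_eq0 => /forallPn[l]; rewrite negb_imply => /andP[lL al].
  by exists l; split; rewrite // lt0n.
pose pL := D L * (\sum_(x < K) a L x)%:R.
pose pl := D l * (\sum_(x < K) a l x)%:R.
(* If [pL <= pl], [L] gives away a task of the lowest level [s], otherwise one of the highest level
   [s + g.+1]. Either way the bound [e] drops by one. *)
have [ple|plt] := leP pL pl.
- have sKK : (s < K)%N by lia.
  have aj' := exchange_allocates Lq lq lL sKK uK as0 al aj.
  have ca := exchange_cost Lq lq lL sKK uK as0 al.
  have [|||a' [s' [t' [? c' ? ? ?]]]] := IHe s _ aj'.
  + exact: sK.
  + move=> x xK; rewrite /exchange eqxx.
    have [->|xu] := eqVneq x u; first by move=> _; lia.
    by move=> h; apply: supp => //; lia.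
  + rewrite /exchange !eqxx.
    have -> : (s == u) = false by apply/eqP; lia.
    have -> : (s + g.+1 == u)%N = false by apply/eqP; lia.
    have -> : (s + g.+1 == s)%N = false by apply/eqP; lia.
    by rewrite !addn0 !subn0; lia.
  exists a', s', t'; split=> //; apply: le_trans c' _.
  rewrite ca gerDl mulr_le0_ge0 ?subr_le0 ?subr_ge0//.
  by apply: V_homo; lia.
- have aj' := exchange_allocates Lq lq lL sK uK at0 al aj.
  have ca := exchange_cost Lq lq lL sK uK at0 al.
  have [|||a' [s' [t' [? c' ? ? ?]]]] := IHe s _ aj'.
  + exact: sK.
  + move=> x xK; rewrite /exchange eqxx.
    have [->|xu] := eqVneq x u; first by move=> _; lia.
    by move=> h; apply: supp => //; lia.
  + rewrite /exchange !eqxx.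
    have -> : (s == u) = false by apply/eqP; lia.
    have -> : (s + g.+1 == u)%N = false by apply/eqP; lia.
    have -> : (s == s + g.+1)%N = false by apply/eqP; lia.
    by rewrite !addn0 !subn0; lia.
  exists a', s', t'; split=> //; apply: le_trans c' _.
  rewrite ca gerDl mulr_ge0_le0 ?subr_le0 ?subr_ge0 ?(ltW plt)//.
  by apply: V_homo; lia.
Qed.

End Allocations.

(** * Candidate vectors and the optimal table *)

Definition dominated (v j : seq nat) : Prop :=
  size v = size j /\ forall u, (nth 0%N v u <= nth 0%N j u)%N.

(** The vector returned by [vsub], without the step count. *)
Definition difference (j v : seq nat) : seq nat :=
  [seq (p.1 - p.2)%N | p <- zip j v].

Lemma size_difference j v : size v = size j -> size (difference j v) = size j.
Proof. by move=> vj; rewrite size_map size_zip vj minnn. Qed.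

Lemma nth_difference j v u : size v = size j ->
  nth 0%N (difference j v) u = (nth 0%N j u - nth 0%N v u)%N.
Proof.
move=> vj; have [uj|ju] := ltnP u (size j); last first.
  by rewrite !nth_default// ?size_difference// ?vj.
by rewrite (nth_map (0, 0)%N) ?nth_zip// size_zip vj minnn.
Qed.

Lemma difference_dominated j v N : size v = size j ->
  dominated j N -> dominated (difference j v) N.
Proof.
move=> vj [jN le_jN]; split; first by rewrite size_difference.
by move=> u; rewrite nth_difference// (leq_trans (leq_subr _ _)).
Qed.

Lemma all_vectorsP N v : reflect (dominated v N) (v \in all_vectors N).
Proof.
elim: N v => [|b N IHN] v.
  rewrite /= inE; apply: (iffP eqP) => [->|[/size0nil]//].
  by split=> // u; rewrite nth_nil.
apply: (iffP (allpairsP (f := cons) (s := iota 0 b.+1) (t := all_vectors N)))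
  => [[[x v'] []]|[]].
  rewrite mem_iota => xb /IHN[sv le_v] ->; split; first by rewrite /= sv.
  by case=> [|u]; [rewrite -ltnS|exact: le_v].
case: v => // x v [sv] le_v; exists (x, v); split=> //.
  by rewrite mem_iota add0n ltnS; exact: (le_v 0%N).
by apply/IHN; split=> // u; exact: (le_v u.+1).
Qed.

Lemma leq_sumn_map (T : eqType) (f : T -> nat) (s : seq T) b :
  {in s, forall x, f x <= b}%N -> (sumn (map f s) <= size s * b)%N.
Proof.
elim: s => //= x s IHs fb; rewrite mulSn leq_add ?fb ?mem_head//.
by apply: IHs => y ys; rewrite fb// inE ys orbT.
Qed.

Lemma size_all_vectors N b : (forall u, nth 0%N N u <= b)%N ->
  (size (all_vectors N) <= b.+1 ^ size N)%N.
Proof.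
elim: N => [|x N IHN] Nb //.
rewrite [size _]size_allpairs size_iota expnS leq_mul//; first exact: (Nb 0%N).
by apply: IHN => u; exact: (Nb u.+1).
Qed.

Lemma nth_block j s t x y u : nth 0%N (block j s t x y) u =
  if (u < size j)%N then
    if u == s then x else if u == t then y
    else if (s < u < t)%N then nth 0%N j u else 0%N
  else 0%N.
Proof.
case: ltnP => [uj|ju]; first by rewrite nth_mkseq.
by rewrite nth_default// size_mkseq.
Qed.

Lemma block_vectorsP j v : reflect
  (exists s t x y, [/\ (s <= t < size j)%N, (x <= nth 0%N j s)%N,
     (y <= nth 0%N j t)%N & v = block j s t x y])
  (v \in block_vectors j).
Proof.
apply: (iffP flattenP) => [[l /allpairsPdep[s [t []]]]|].
  rewrite !mem_iota => sj tj -> /allpairsP[[x y] []].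
  rewrite !mem_iota => /= xs yt ->; exists s, t, x, y; split=> //; lia.
case=> s [t [x [y [st xs yt ->]]]].
exists [seq block j s t x y | x <- iota 0 (nth 0%N j s).+1,
                              y <- iota 0 (nth 0%N j t).+1].
  by apply/allpairsPdep; exists s, t; rewrite !mem_iota; split=> //; lia.
by apply/allpairsP; exists (x, y); rewrite !mem_iota; split=> //=; lia.
Qed.

Lemma block_vectors_dominated j v : v \in block_vectors j -> dominated v j.
Proof.
case/block_vectorsP=> s [t [x [y [st xs yt ->]]]].
split; first by rewrite size_mkseq.
move=> u; rewrite nth_block; case: ifP => // _.
by do 2?[case: eqP => [->//|_]]; case: ifP.
Qed.

(** A block is fixed by its two end positions and its two end values, since [j] dictates the
    interior. The exponent of [b.+1] is thus 2, whatever the number of levels. *)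
Lemma size_block_vectors j b : (forall u, nth 0%N j u <= b)%N ->
  (size (block_vectors j) <= size j ^ 2 * b.+1 ^ 2)%N.
Proof.
move=> jb; rewrite size_flatten /shape.
apply: leq_trans (leq_sumn_map (b := (b.+1 ^ 2)%N) _) _ => [l|].
  case/allpairsPdep=> s [t [_ _ ->]].
  by rewrite size_allpairs !size_iota -mulnn leq_mul// ltnS.
rewrite leq_mul// size_allpairs_dep.
apply: leq_trans (leq_sumn_map (b := size j) _) _ => [s _|].
  by rewrite size_iota leq_subr.
by rewrite size_iota mulnn.
Qed.

(** * The table as a pure recursion, and its optimality *)

Section OptimalTable.
Variables (R : realType) (D V : nat -> R) (K : nat).
Variable cands : seq nat -> seq (seq nat).

Notation resource_cost := (resource_cost D V K).
Notation alloc_cost := (alloc_cost D V K).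
Notation allocates := (allocates K).

(** Specification of the timed table. The fold starts with the null vector, so leaving resource [q]
    empty is always considered. *)
Fixpoint opt_table (q : nat) (j : seq nat) : R * seq nat :=
  if q is q'.+1 then
    foldl (fun best v =>
             let c := (opt_table q' (difference j v)).1 +
                      resource_cost q (nth 0%N v) in
             if c < best.1 then (c, v) else best)
          ((opt_table q' j).1, nseq (size j) 0%N) (cands j)
  else (resource_cost 0 (nth 0%N j), j).

Definition valid_cands : Prop :=
  forall j v, size j = K -> v \in cands j -> dominated v j.

(** All resources may change, not only the last one: turning the last vector into a block trades
    tasks with the others. *)
Definition sufficient_cands : Prop :=
  forall q a j, size j = K -> allocates q.+1 a j ->
  exists a', [/\ allocates q.+1 a' j, alloc_cost q.+1 a' <= alloc_cost q.+1 a
    & mkseq (a' q.+1) K \in cands j].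

Lemma foldl_min (T : eqType) (f : T -> R) (s : seq T) (b : R * T) :
  let r := foldl (fun best v => if f v < best.1 then (f v, v) else best) b s in
  [/\ r.1 <= b.1, {in s, forall v, r.1 <= f v} &
      r = b \/ exists2 v, v \in s & r = (f v, v)].
Proof.
elim: s b => [|x s IHs] b /=; first by split=> //; left.
have [le1 le2 r_eq] := IHs (if f x < b.1 then (f x, x) else b).
split.
- by apply: le_trans le1 _; case: ltP => [/ltW|].
- move=> v; rewrite inE => /predU1P[->|/le2//].
  by apply: le_trans le1 _; case: ltP.
- case: r_eq => [->|[v vs ->]]; last first.
    by right; exists v; rewrite // inE vs orbT.
  by case: ifP => _; [right; exists x; rewrite ?mem_head|left].
Qed.

Lemma resource_cost0 l : resource_cost l (nth 0%N (nseq K 0%N)) = 0.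
Proof.
rewrite /resource_cost [X in _ * X]big1 ?mulr0// => u _.
by rewrite nth_nseq ltn_ord mul0r.
Qed.

Lemma difference0 j : difference j (nseq (size j) 0%N) = j.
Proof.
apply: (@eq_from_nth _ 0%N); first by rewrite size_difference// size_nseq.
by move=> u _; rewrite nth_difference ?size_nseq// nth_nseq if_same subn0.
Qed.

(** The stored vector accounts for the stored value, which is what the traceback relies on. The null
    starting vector fits too: it costs nothing and leaves [j] unchanged. *)
Lemma opt_tableS q j : valid_cands -> size j = K ->
  let v := (opt_table q.+1 j).2 in dominated v j /\
  (opt_table q.+1 j).1 =
    (opt_table q (difference j v)).1 + resource_cost q.+1 (nth 0%N v).
Proof.
move=> cands_valid jK /=.
have [_ _] := foldl_min (fun v => (opt_table q (difference j v)).1 +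
  resource_cost q.+1 (nth 0%N v)) (cands j)
  ((opt_table q j).1, nseq (size j) 0%N).
case=> [->|[v vj ->]] /=; last by split=> //; exact: cands_valid.
split; last by rewrite difference0 jK resource_cost0 addr0.
by split=> [|u]; rewrite ?size_nseq// nth_nseq if_same.
Qed.

(** Induction on [q]: once [a] is replaced by an allocation whose last vector is a candidate, the
    other resources allocate the difference, and the induction hypothesis bounds their cost. *)
Lemma opt_table_le q a j : valid_cands -> sufficient_cands ->
  size j = K -> allocates q a j -> (opt_table q j).1 <= alloc_cost q a.
Proof.
move=> cands_valid cands_ok; elim: q a j => [|q IHq] a j jK aj.
  rewrite /= /alloc_cost big_ord1.
  rewrite (@eq_resource_cost R D V K _ (nth 0%N j) (a 0%N))// => u uK.
  by rewrite -aj// big_ord1.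
have [a' [aj' le_a v_in]] := cands_ok _ _ _ jK aj.
set v := mkseq _ _ in v_in; apply: le_trans le_a.
have [_ /(_ v v_in) + _] := foldl_min (fun v =>
  (opt_table q (difference j v)).1 + resource_cost q.+1 (nth 0%N v)) (cands j)
  ((opt_table q j).1, nseq (size j) 0%N).
move=> /le_trans; apply.
have vK : size v = K by rewrite size_mkseq.
rewrite /alloc_cost big_ord_recr/=; apply: lerD.
  apply: IHq; first by rewrite size_difference ?jK.
  move=> u uK; rewrite nth_difference ?jK// nth_mkseq// -aj'//.
  by rewrite [in RHS]big_ord_recr/= addnK.
by rewrite (@eq_resource_cost R D V K _ (nth 0%N v) (a' q.+1))// => u uK;
  rewrite nth_mkseq.
Qed.

End OptimalTable.

Lemma all_vectors_sufficient (R : realType) (D V : nat -> R) K :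
  sufficient_cands D V K all_vectors.
Proof.
move=> q a j jK aj; exists a; split=> //; apply/all_vectorsP.
split=> [|u]; first by rewrite size_mkseq.
have [uK|Ku] := ltnP u K; last by rewrite nth_default// size_mkseq.
by rewrite nth_mkseq//; exact: alloc_le aj _ _.
Qed.

Lemma block_vectors_sufficient (R : realType) (D V : nat -> R) k :
  (forall s t, (s <= t)%N -> (t < k.+1)%N -> V s <= V t) ->
  sufficient_cands D V k.+1 block_vectors.
Proof.
move=> V_homo q a j jK aj.
(* The starting range is [[0, k]], which contains every level. *)
have [||a' [s [t [aj' le_a st supp full]]]] :=
  block_alloc D V_homo (ltnSn _) (g := k) (s := 0%N) aj _ _ (leqnn _).
- by rewrite add0n.
- by move=> x xk _; rewrite add0n -ltnS.
exists a'; split=> //; apply/block_vectorsP.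
have [tk st'] : (t < k.+1)%N /\ (s <= t)%N by case/andP: st.
have sk := leq_ltn_trans st' tk.
exists s, t, (a' q.+1 s), (a' q.+1 t); rewrite jK; split=> //.
- exact: alloc_le aj' _ _.
- exact: alloc_le aj' _ _.
apply: (@eq_from_nth _ 0%N); first by rewrite !size_mkseq.
rewrite size_mkseq => u uk; rewrite nth_mkseq// nth_block jK uk.
have [->//|us] := eqVneq u s; have [->//|ut] := eqVneq u t.
case: ifP => [/full//|stu]; apply/eqP; rewrite -leqn0 leqNgt.
by apply/negP => /(supp u uk); lia.
Qed.

(** * Timed programs and the dynamic program *)

(** A Hoare-style judgement with a step budget, so that correctness and run time are proved in one
    pass through a program. *)
Definition achieves (T : Type) (c : nat) (Q : T -> Prop) (p : timed T) : Prop :=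
  Q (result p) /\ (steps p <= c)%N.

Lemma achieves_charge (T : Type) c c' (x : T) (Q : T -> Prop) :
  Q x -> (c <= c')%N -> achieves c' Q (Defs.charge c x).
Proof. by []. Qed.

Lemma achieves_bind (S T : Type) a c (P : S -> Prop) (Q : T -> Prop)
    p (f : S -> timed T) :
  achieves a P p -> (a <= c)%N -> (forall x, P x -> achieves (c - a) Q (f x)) ->
  achieves c Q (bind p f).
Proof.
case: p => x b [/= Px ba ac] /(_ x Px); rewrite /bind; case: (f x) => y e.
by case=> /= Qy ec; split=> //; rewrite /steps/=; lia.
Qed.

Lemma achieves_weaken (T : Type) a c (P Q : T -> Prop) p :
  (forall x, P x -> Q x) -> (a <= c)%N -> achieves a P p -> achieves c Q p.
Proof. by move=> PQ ac [Pp pa]; split; [exact: PQ|exact: leq_trans ac]. Qed.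

Lemma achieves_loop_cons (S T : Type) b c (P Q : T -> Prop)
    (body : T -> S -> timed T) i s acc :
  achieves b P (body acc i) ->
  (forall x, P x -> achieves c Q (loop body s x)) ->
  achieves (b.+1 + c) Q (loop body (i :: s) acc).
Proof.
move=> bodyP loopP; apply: (achieves_bind bodyP); first by lia.
move=> x Px; apply: (achieves_bind (a := 1) (P := eq x)).
  exact: achieves_charge.
  by lia.
by move=> _ <-; apply: (achieves_weaken _ _ (loopP x Px)) => //; lia.
Qed.

(** The invariant is indexed by the prefix already processed; [b.+1] is the cost of the body plus
    the step charged for each iteration. *)
Lemma achieves_loop (S T : Type) b (P : seq S -> T -> Prop)
    (body : T -> S -> timed T) s acc :
  P [::] acc ->
  (forall s1 i s2 x, s = s1 ++ i :: s2 -> P s1 x ->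
     achieves b (P (rcons s1 i)) (body x i)) ->
  achieves (size s * b.+1) (P s) (loop body s acc).
Proof.
move=> P0 bodyP.
suff: forall s2 s1 x, s = s1 ++ s2 -> P s1 x ->
    achieves (size s2 * b.+1) (P s) (loop body s2 x).
  by move=> /(_ s [::]); apply.
elim=> [|i s2 IHs2] s1 x sE Px; first by rewrite sE cats0.
rewrite /= mulSn.
apply: achieves_loop_cons (bodyP _ _ _ _ sE Px) _ => y Py.
by apply: IHs2 Py; rewrite cat_rcons.
Qed.

Lemma result_loop (S T : Type) (body : T -> S -> timed T) s acc :
  result (loop body s acc) = foldl (fun x i => result (body x i)) acc s.
Proof.
elim: s acc => //= i s IHs acc; rewrite -IHs.
by case: (body acc i) => y e /=; rewrite /charge/=; case: (loop _ _ _).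
Qed.

(* Searching s from its end, every hit overwrites the previous ones. *)
Lemma achieves_search c (p : pred nat) (s : seq nat) (x : nat) :
  achieves (size s * c.+1) (eq (nth x s (find p s)))
    (loop (fun y t => Defs.charge c (if p t then t else y)) (rev s) x).
Proof.
split; last first.
  have [_] := @achieves_loop nat nat c (fun _ _ => True)
    (fun y t => Defs.charge c (if p t then t else y)) (rev s) x I
    (fun _ _ _ _ _ _ => achieves_charge I (leqnn c)).
  by rewrite size_rev.
rewrite result_loop foldl_rev; elim: s => //= t s <-.
by case: (p t).
Qed.

(** * Correctness and run time of filling and reading the table *)

Section TableSpec.
Variables (R : realType) (m K M : nat).
Variable cands : seq nat -> seq (seq nat).
Variables (d : 'I_m.+1 -> R) (V : nat -> R) (N : seq nat).
Hypothesis NK : size N = K.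
Hypothesis cands_valid : valid_cands K cands.
Hypothesis cands_size :
  forall j, j \in all_vectors N -> (size (cands j) <= M)%N.

Definition delay (l : nat) : R := d (inord l).

Notation resource_cost := (resource_cost delay V K).
Notation alloc_cost := (alloc_cost delay V K).
Notation allocates := (allocates K).
Notation opt_table := (opt_table delay V K cands).

Lemma group_cost_spec q v : size v = K ->
  achieves (6 * K + 3) (eq (resource_cost q (nth 0%N v))) (group_cost d V q v).
Proof.
move=> vK; pose P s (x : nat * R) := x =
  ((\sum_(t <- s) nth 0 v t)%N, \sum_(t <- s) (nth 0%N v t)%:R * V t).
apply: (achieves_bind (a := (6 * K)%N) (P := P (iota 0 (size v)))).
- rewrite -vK -[X in (_ * X)%N](size_iota 0 (size v)) mulnC.
  apply: achieves_loop; first by rewrite /P !big_nil.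
  move=> s1 i s2 _ _ ->; apply: achieves_charge => //.
  by rewrite /P !big_rcons/=.
- by lia.
- move=> _ ->; apply: achieves_charge; last by lia.
  have -> : iota 0 (size v) = index_iota 0 K by rewrite /index_iota subn0 vK.
  by rewrite !big_mkord.
Qed.

Definition filled (q : nat) (tab : table R) : Prop :=
  forall q' j, (q' <= q)%N -> j \in all_vectors N ->
  tab (q', j) = opt_table q' j.

Lemma size_of_vector j : j \in all_vectors N -> size j = K.
Proof. by move/all_vectorsP => [-> _]. Qed.

Lemma first_row_spec tab :
  achieves (size (all_vectors N) * (8 * K + 5)) (filled 0)
    (first_row d V N tab).
Proof.
pose P (s : seq (seq nat)) (tab : table R) :=
  forall j, j \in s -> tab (0%N, j) = opt_table 0 j.
apply: (achieves_weaken (a := (size (all_vectors N) * (8 * K + 4).+1)%N)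
  (P := P (all_vectors N))); last first.
- apply: achieves_loop => // s1 j s2 tab1 sE Ptab.
  have jN : j \in all_vectors N by rewrite sE mem_cat mem_head orbT.
  have jK := size_of_vector jN; rewrite jK.
  apply: (achieves_bind (a := K) (P := eq j)); first exact: achieves_charge.
    by lia.
  move=> _ <-; apply: (achieves_bind (group_cost_spec 0 jK)).
    by lia.
  move=> _ <-; apply: achieves_charge; last by rewrite jK; lia.
  move=> j'; rewrite mem_rcons inE xpair_eqE eqxx/=.
  by case: eqP => [->//|_]; exact: Ptab.
- by rewrite leq_mul2l; apply/orP; right; lia.
- by move=> tab1 Ptab q j; rewrite leqn0 => /eqP -> /Ptab.
Qed.

(** A candidate takes [9 * K + 7] steps: [3 * K + 1] for handling vectors, [6 * K + 3] for
    [group_cost], 2 for the addition and the comparison, 1 for the iteration. *)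
Lemma entry_spec q j tab : filled q tab -> j \in all_vectors N ->
  achieves (K.+1 + M * (9 * K + 7)) (eq (opt_table q.+1 j))
    (entry cands d V q j tab).
Proof.
move=> fill jN; have jK := size_of_vector jN.
apply: (achieves_bind (a := K.+1) (P := eq (opt_table q j))).
- by apply: achieves_charge; rewrite ?jK// fill.
- by lia.
move=> _ <-; rewrite addKn.
pose f (best : R * seq nat) v :=
  let c := (opt_table q (difference j v)).1 + resource_cost q.+1 (nth 0%N v) in
  if c < best.1 then (c, v) else best.
pose P s x := foldl f ((opt_table q j).1, nseq (size j) 0%N) s = x.
apply: (achieves_weaken (a := (size (cands j) * (9 * K + 6).+1)%N)
  (P := P (cands j))) => //.
  by rewrite -addnS leq_mul2r cands_size// orbT.
apply: achieves_loop => // s1 v s2 x sE <-.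
have vj : v \in cands j by rewrite sE mem_cat mem_head orbT.
have dvj := cands_valid jK vj; have [vsz _] := dvj.
have vK : size v = K by rewrite vsz.
(* Valid candidates leave a vector that is again an index of the table, where row [q] is known. *)
have dN : difference j v \in all_vectors N.
  by apply/all_vectorsP; apply: difference_dominated => //; exact/all_vectorsP.
apply: (achieves_bind (a := K) (P := eq v)).
  by apply: achieves_charge; rewrite ?vK.
  by lia.
move=> _ <-; apply: (achieves_bind (a := K) (P := eq (difference j v))).
  by apply: achieves_charge; rewrite ?jK.
  by lia.
move=> _ <-; apply: (achieves_bind (a := K.+1)
  (P := eq (opt_table q (difference j v)))).
  by apply: achieves_charge; rewrite ?size_difference ?jK// fill.
  by lia.
move=> _ <-; apply: (achieves_bind (group_cost_spec q.+1 vK)).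
  by lia.
move=> _ <-; apply: (achieves_bind (a := 1) (P := eq
  ((opt_table q (difference j v)).1 + resource_cost q.+1 (nth 0%N v)))).
  exact: achieves_charge.
  by lia.
move=> _ <-; apply: achieves_charge; last by lia.
by rewrite /P foldl_rcons.
Qed.

Lemma next_row_spec q tab : filled q tab ->
  achieves (size (all_vectors N) * (3 * K + M * (9 * K + 7) + 3))
    (filled q.+1) (next_row cands d V N q tab).
Proof.
move=> fill.
(* New entries are computed from row [q], so the invariant also records that the earlier rows
   survive the writes. *)
pose P (s : seq (seq nat)) (tab : table R) := filled q tab /\
  forall j, j \in s -> tab (q.+1, j) = opt_table q.+1 j.
apply: (achieves_weaken (a := (size (all_vectors N) *
    (3 * K + M * (9 * K + 7) + 2).+1)%N) (P := P (all_vectors N))); last first.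
- apply: achieves_loop => // s1 j s2 tab1 sE [fill1 Ptab].
  have jN : j \in all_vectors N by rewrite sE mem_cat mem_head orbT.
  have jK := size_of_vector jN; rewrite jK.
  apply: (achieves_bind (a := K) (P := eq j)); first exact: achieves_charge.
    by lia.
  move=> _ <-.
  apply: (achieves_bind (entry_spec fill1 jN)).
    by lia.
  move=> _ <-; apply: achieves_charge; last by rewrite jK; lia.
  split=> [q' j' q'q j'N|j'].
    rewrite xpair_eqE; have -> : (q' == q.+1) = false by apply/eqP; lia.
    exact: fill1.
  rewrite mem_rcons inE xpair_eqE eqxx/=.
  by case: eqP => [->//|_]; exact: Ptab.
- by rewrite leq_mul2l; apply/orP; right; lia.
- move=> tab1 [fill1 Ptab] q' j; rewrite leq_eqVlt => /predU1P[->|]; last first.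
    exact: fill1.
  exact: Ptab.
Qed.

(** [a] stands for the number of entries in a row. *)
Definition fill_bound (a : nat) : nat :=
  (a * (8 * K + 5) + m * (a * (3 * K + M * (9 * K + 7) + 3)).+1)%N.

Lemma fill_table_spec :
  achieves (fill_bound (size (all_vectors N))) (filled m)
    (fill_table cands d V N).
Proof.
apply: (achieves_bind (first_row_spec (fun=> (0, [::])))).
  exact: leq_addr.
move=> tab0 fill0; rewrite addKn.
have := @achieves_loop nat (table R) _ (fun s => filled (size s))
  (fun tab q => next_row cands d V N q tab) (iota 0 m) tab0 fill0 _.
rewrite size_iota; apply => s1 q s2 tab1 sE fill1.
(* The invariant counts finished rows by the length of the prefix, which in [iota 0 m] is the
   current index. *)
have -> : q = size s1.
  have := congr1 (nth 0%N ^~ (size s1)) sE; rewrite nth_cat ltnn subnn/=.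
  have := congr1 size sE; rewrite size_iota size_cat/= => mE.
  by rewrite nth_iota ?mE//; lia.
by rewrite size_rcons; exact: next_row_spec.
Qed.

(** Going down from resource [m], each stored vector splits the cost of one resource off the entry,
    by [opt_tableS]; the allocation therefore attains the optimal value. *)
Lemma traceback_spec tab : filled m tab ->
  achieves (m.+1 * (3 * K + 2))
    (fun al => allocates m (fun l => nth 0%N (al l)) N /\
       alloc_cost m (fun l => nth 0%N (al l)) = (opt_table m N).1)
    (traceback m N tab).
Proof.
move=> fill.
pose body (st : (nat -> seq nat) * seq nat) q :=
  bind (read (size st.2).+1 tab (q, st.2)) (fun e : R * seq nat =>
  bind (write (size e.2) st.1 q e.2) (fun alloc =>
  bind (vsub st.2 e.2) (fun rest => Defs.charge 0 (alloc, rest)))).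
have bodyP q al j : (q <= m)%N -> j \in all_vectors N ->
    achieves (3 * K + 1)
      (eq ((fun l => if l == q then (opt_table q j).2 else al l),
           difference j (opt_table q j).2)) (body (al, j) q).
  move=> qm jN; have jK := size_of_vector jN.
  apply: (achieves_bind (a := K.+1) (P := eq (opt_table q j))).
  - by apply: achieves_charge; rewrite ?jK// fill.
  - by lia.
  move=> _ <-.
  have eK : size (opt_table q j).2 = K.
    case: q qm => [|q] qm //.
    by have [[-> _] _] := opt_tableS delay V q cands_valid jK.
  apply: (achieves_bind (a := K)
    (P := eq (fun l => if l == q then (opt_table q j).2 else al l))).
    by apply: achieves_charge; rewrite ?eK.
    by lia.
  move=> _ <-.
  apply: (achieves_bind (a := K) (P := eq (difference j (opt_table q j).2))).
    by apply: achieves_charge; rewrite ?jK.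
    by lia.
  by move=> _ <-; exact: achieves_charge.
have rev_iotaS q : rev (iota 0 q.+1) = q :: rev (iota 0 q).
  by rewrite -addn1 iotaD rev_cat.
(* The first clause says that vectors chosen for higher resources are not overwritten; the induction
   step uses it to recover the vector of [q.+1]. *)
have loopP q : forall al j, (q <= m)%N -> j \in all_vectors N ->
    achieves (q.+1 * (3 * K + 2)) (fun st : (nat -> seq nat) * seq nat =>
      [/\ forall l, (q < l)%N -> st.1 l = al l,
         allocates q (fun l => nth 0%N (st.1 l)) j &
         alloc_cost q (fun l => nth 0%N (st.1 l)) = (opt_table q j).1])
    (loop body (rev (iota 0 q.+1)) (al, j)).
  elim: q => [|q IHq] al j qm jN.
    rewrite rev_iotaS.
    rewrite (_ : (1 * (3 * K + 2))%N = ((3 * K + 1).+1 + 0)%N); last by lia.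
    apply: achieves_loop_cons; first exact: bodyP.
    move=> _ <-; apply: achieves_charge => //=; split.
    - by case.
    - by move=> u uK; rewrite big_ord1.
    - by rewrite /alloc_cost big_ord1.
  rewrite rev_iotaS.
  rewrite (_ : (q.+2 * (3 * K + 2))%N =
    ((3 * K + 1).+1 + q.+1 * (3 * K + 2))%N); last by lia.
  apply: achieves_loop_cons; first exact: bodyP.
  have jK := size_of_vector jN.
  move=> _ <-.
  have [[vj le_v] costE] := opt_tableS delay V q cands_valid jK.
  set v := (opt_table q.+1 j).2 in vj le_v costE *.
  have dN : difference j v \in all_vectors N.
    apply/all_vectorsP; apply: difference_dominated => //.
    exact/all_vectorsP.
  apply: (achieves_weaken _ (leqnn _)
    (IHq (fun l => if l == q.+1 then v else al l) _ (ltnW qm) dN)).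
  case=> al' rest /= [keep alloc_ok cost_ok].
  have al'q : al' q.+1 = v by rewrite keep// eqxx.
  split.
  - by move=> l ql; rewrite keep ?(ltnW ql)//; case: eqP => // lq; lia.
  - move=> u uK; rewrite big_ord_recr/= alloc_ok// al'q nth_difference//.
    by rewrite subnK.
  - by rewrite /alloc_cost big_ord_recr/= al'q [X in X + _]cost_ok -costE.
apply: (achieves_bind (loopP m (fun=> [::]) N (leqnn m) _)) => //.
  by apply/all_vectorsP.
by move=> st [_ ? ?]; exact: achieves_charge.
Qed.

End TableSpec.

(** * Rounding *)

Section RoundingBounds.
Variables (R : realType) (n k : nat) (w : 'I_n.+1 -> R).
Hypothesis w_ge1 : forall i, 1 <= w i.
Hypothesis w_sorted : forall i i' : 'I_n.+1, (i <= i')%N -> w i' <= w i.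
Hypothesis k_gt0 : (0 < k)%N.

Lemma weight_gt0 i : 0 < w i. Proof. exact: lt_le_trans ltr01 (w_ge1 i). Qed.

Lemma weight_ratio_ge1 : 1 <= weight_ratio w.
Proof. by rewrite ler_pdivlMr ?weight_gt0// mul1r w_sorted. Qed.

Let ratio_gt0 : 0 < weight_ratio w.
Proof. exact: lt_le_trans weight_ratio_ge1. Qed.

Lemma grid_homo s t : (s <= t)%N -> grid w k s <= grid w k t.
Proof.
move=> st; rewrite /grid ler_pM2l ?weight_gt0//.
apply: ler_powR; first exact: weight_ratio_ge1.
by rewrite ler_pM2r ?invr_gt0 ?ltr0n// ler_nat.
Qed.

Lemma gridS t : grid w k t.+1 = grid w k t * weight_ratio w `^ k%:R^-1.
Proof.
rewrite /grid -mulrA -powRD; last by rewrite (gt_eqF ratio_gt0) implybT.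
by rewrite -natr1 mulrDl mul1r.
Qed.

Lemma grid0 : grid w k 0 = w ord_max.
Proof. by rewrite /grid mul0r powRr0 mulr1. Qed.

Lemma grid_last : grid w k k = w ord0.
Proof.
rewrite /grid divff ?pnatr_eq0 ?gt_eqF// powRr1 ?(ltW ratio_gt0)//.
by rewrite mulrC divfK// gt_eqF ?weight_gt0.
Qed.

(** The last grid value is the largest weight, so the search for a level never fails. *)
Lemma has_level i : has (fun t => w i <= grid w k t) (iota 0 k.+1).
Proof.
apply/hasP; exists k; first by rewrite mem_iota add0n ltnSn.
by rewrite grid_last w_sorted.
Qed.

Lemma level_le i : (level w k i <= k)%N.
Proof. by rewrite -ltnS -[ltnRHS](size_iota 0) -has_find has_level. Qed.

Lemma le_rounded i : w i <= rounded w k i.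
Proof.
have := nth_find 0%N (has_level i).
by rewrite nth_iota ?add0n// ltnS level_le.
Qed.

(** If the level is [t.+1], minimality gives [grid w k t < w i], and one grid step multiplies by at
    most [1 + eps]. At level 0 the rounded weight is the smallest weight. *)
Lemma rounded_le (eps : R) i : weight_ratio w `^ k%:R^-1 <= 1 + eps ->
  rounded w k i <= (1 + eps) * w i.
Proof.
(* A root of a ratio that is at least 1 is at least 1. *)
move=> ratio_le; have eps_ge1 : 1 <= 1 + eps.
  apply: le_trans ratio_le; have pow1 : (1 : R) `^ k%:R^-1 = 1 by rewrite powR1.
  rewrite -[leLHS]pow1 ge0_ler_powR ?nnegrE ?invr_ge0// ?(ltW ratio_gt0)//.
  exact: weight_ratio_ge1.
rewrite /rounded; case levelE : (level w k i) => [|t].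
  rewrite grid0 (le_trans (w_sorted (i := i) (i' := ord_max) _)) ?leq_ord//.
  by rewrite ler_peMl// ltW ?weight_gt0.
have /(before_find 0%N) : (t < level w k i)%N by rewrite levelE.
rewrite nth_iota ?add0n; last by have := level_le i; rewrite levelE; lia.
move/negbT; rewrite -ltNge => /ltW le_w; rewrite gridS mulrC.
apply: ler_pM => //; first exact: powR_ge0.
by rewrite mulr_ge0 ?powR_ge0 ?ltW ?weight_gt0.
Qed.

Lemma size_undup_rounded : (size (undup (codom (rounded w k))) <= k.+1)%N.
Proof.
rewrite -[leqRHS](size_iota 0) -(size_map (grid w k)).
apply: uniq_leq_size; first exact: undup_uniq.
move=> x; rewrite mem_undup => /codomP[i ->].
by apply/mapP; exists (level w k i); rewrite // mem_iota add0n ltnS level_le.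
Qed.

End RoundingBounds.

(** * Effect of rounding on the optimal cost *)

Section Approximation.
Variables (R : realType) (m n : nat) (d : 'I_m.+1 -> R).
Hypothesis d_gt0 : forall l, 0 < d l.

Lemma cost_le (w w' : 'I_n.+1 -> R) (A : assignment m n) :
  (forall i, w i <= w' i) -> cost d w A <= cost d w' A.
Proof.
move=> ww'; apply: ler_sum => i _; rewrite /load ler_pM2l//.
by apply: ler_sum => i' _; exact: ww'.
Qed.

Lemma costZ c (w : 'I_n.+1 -> R) (A : assignment m n) :
  cost d (fun i => c * w i) A = c * cost d w A.
Proof.
rewrite /cost mulr_sumr; apply: eq_bigr => i _.
by rewrite /load -mulr_sumr mulrCA.
Qed.

(** Compare [A'] with [A] under [w'], then use that the cost is monotone and linear in the
    weights. *)
Lemma optimal_approx (eps : R) (w w' : 'I_n.+1 -> R) (A' A : assignment m n) :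
  (forall i, w' i <= (1 + eps) * w i) -> optimal d w' A' ->
  cost d w' A' <= (1 + eps) * cost d w A.
Proof.
move=> w'_le A'_opt; apply: le_trans (A'_opt A) _.
by rewrite -costZ; exact: cost_le.
Qed.

End Approximation.

(** * The scheme *)

Lemma count_enum (T : finType) (P : pred T) :
  count P (enum T) = (\sum_i (P i : nat))%N.
Proof. by rewrite -sum1_count big_mkcond/= big_enum. Qed.

(** * From assignments to numbers of tasks per resource and level *)

Section Counts.
Variables (R : realType) (m n K : nat).
Variables (d : 'I_m.+1 -> R) (V : nat -> R) (lev : 'I_n.+1 -> nat).
Hypothesis lev_lt : forall i, (lev i < K)%N.
Implicit Type A : assignment m n.

Definition counts A (l u : nat) : nat :=
  count (fun i => (A i == l :> nat) && (lev i == u)) (enum 'I_n.+1).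

Definition level_counts (N : seq nat) : Prop :=
  size N = K /\
  forall u, nth 0%N N u = count (fun i => lev i == u) (enum 'I_n.+1).

Lemma countsE A l u :
  counts A l u = (\sum_i ((A i == l :> nat) && (lev i == u) : nat))%N.
Proof. exact: count_enum. Qed.

Lemma counts_allocates A N : level_counts N -> allocates K m (counts A) N.
Proof.
move=> [_ NE] u _; rewrite NE count_enum.
under [LHS]eq_bigr do rewrite countsE.
rewrite [LHS]exchange_big/=; apply: eq_bigr => i _.
rewrite (bigD1 (A i))//= eqxx big1 ?addn0; first by case: (lev i == u).
by move=> l lA; rewrite eq_sym (negPf lA : (l == A i :> nat) = false).
Qed.

(** Grouped by resource, all tasks on [l] pay the same load, which depends only on the counts. This
    links the cost of assignments to that of allocations. *)
Lemma cost_counts A :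
  cost d (fun i => V (lev i)) A = alloc_cost (delay d) V K m (counts A).
Proof.
rewrite /cost (partition_big A predT)//=; apply: eq_bigr => l _.
rewrite /resource_cost /delay inord_val.
have nE : (\sum_(u < K) counts A l u = \sum_(i | A i == l) 1)%N.
  under [LHS]eq_bigr do rewrite countsE.
  rewrite [LHS]exchange_big/= [RHS]big_mkcond/=; apply: eq_bigr => i _.
  rewrite (bigD1 (Ordinal (lev_lt i)))//= eqxx andbT big1 ?addn0.
    by rewrite val_eqE; case: (A i == l).
  move=> u; rewrite -val_eqE/= eq_sym => /negPf ->.
  by rewrite andbF.
have WE : \sum_(u < K) (counts A l u)%:R * V u = \sum_(i | A i == l) V (lev i).
  under [LHS]eq_bigr do rewrite countsE natr_sum mulr_suml.
  rewrite [LHS]exchange_big/= [RHS]big_mkcond/=; apply: eq_bigr => i _.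
  rewrite (bigD1 (Ordinal (lev_lt i)))//= eqxx andbT big1 ?addr0.
    by rewrite val_eqE; case: (A i == l); rewrite ?mul1r ?mul0r.
  move=> u; rewrite -val_eqE/= eq_sym => /negPf ->.
  by rewrite andbF mul0r.
rewrite nE WE [d l * _]mulrC -mulrA natr_sum [RHS]mulr_suml.
by apply: eq_bigr => i /eqP Ai; rewrite mul1r /load Ai.
Qed.

End Counts.

(** * Correctness and run time of the whole scheme *)

Section SchemeSpec.
Variables (R : realType) (m n k M : nat).
Variable cands : seq nat -> seq (seq nat).
Variables (d : 'I_m.+1 -> R) (w : 'I_n.+1 -> R).
Hypothesis cands_valid : valid_cands k.+1 cands.
Hypothesis cands_size : forall j, size j = k.+1 ->
  (forall u, nth 0%N j u <= n.+1)%N -> (size (cands j) <= M)%N.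
Hypothesis level_le : forall i, (level w k i <= k)%N.

Let K := k.+1.

(** Restricted to [t <= k] because the array keeps its default 0 beyond. *)
Definition grid_table (V : nat -> R) : Prop :=
  forall t, (t <= k)%N -> V t = grid w k t.

Hypothesis cands_sufficient : forall V, grid_table V ->
  sufficient_cands (delay d) V K cands.

Lemma grid_values_spec : achieves (6 * K) grid_table (grid_values k w).
Proof.
pose P (s : seq nat) (V : nat -> R) := forall t, t \in s -> V t = grid w k t.
apply: (achieves_weaken (a := (size (iota 0 K) * 6)%N) (P := P (iota 0 K))).
- by move=> V VP t tk; apply: VP; rewrite mem_iota add0n ltnS.
- by rewrite size_iota mulnC.
apply: achieves_loop => // s1 t s2 V _ VP.
apply: (achieves_bind (a := 4) (P := eq (grid w k t))) => //.
move=> _ <-; apply: achieves_charge => // t'.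
by rewrite mem_rcons inE; case: eqP => [->//|_]; exact: VP.
Qed.

Lemma find_level_spec V i : grid_table V ->
  achieves (4 * K) (eq (level w k i)) (find_level k w V i).
Proof.
move=> VP; have levE : find (fun t => w i <= V t) (iota 0 K) = level w k i.
  apply: eq_in_find => t; rewrite mem_iota add0n => /= tK.
  by rewrite VP.
apply: (achieves_weaken _ _
  (achieves_search 3 (fun t => w i <= V t) (iota 0 K) k)).
  by move=> _ <-; rewrite levE nth_iota// ltnS level_le.
by rewrite size_iota mulnC.
Qed.

Lemma levels_spec V : grid_table V ->
  achieves (n.+1 * (4 * K + 3))
    (fun st => st.1 =1 level w k /\ level_counts K (level w k) st.2)
    (levels k w V).
Proof.
move=> VP.
pose P (s : seq 'I_n.+1) (st : ('I_n.+1 -> nat) * seq nat) :=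
  [/\ forall i, i \in s -> st.1 i = level w k i, size st.2 = K &
      forall u, nth 0%N st.2 u = count (fun i => level w k i == u) s].
apply: (achieves_weaken (a := (size (enum 'I_n.+1) * (4 * K + 2).+1)%N)
  (P := P (enum 'I_n.+1))).
- by move=> st [levE sz cnt]; split=> // i; rewrite levE// mem_enum.
- by rewrite size_enum_ord -addnS.
apply: achieves_loop.
  by split=> [i||u]; rewrite ?size_nseq// nth_nseq if_same.
move=> s1 i s2 [lev N] sE [levE sz cnt].
apply: (achieves_bind (find_level_spec i VP)); first by lia.
move=> _ <-; apply: (achieves_bind (a := 1)
  (P := eq (fun i' => if i' == i then level w k i else lev i'))).
- exact: achieves_charge.
- by lia.
move=> _ <-; apply: achieves_charge; last by lia.
split=> /= [i'||u].
- by rewrite mem_rcons inE; case: eqP => [->//|_]; exact: levE.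
- by rewrite size_incr_nth [size _]sz ltnS level_le.
- by rewrite nth_incr_nth -cats1 count_cat/= cnt addn0 addnC.
Qed.

(** The greedy choice never gets stuck: at each level, the room left over all resources equals the
    number of tasks still to be placed. *)
Lemma distribute_spec (lev : 'I_n.+1 -> nat) (alloc : nat -> seq nat) N :
  lev =1 level w k -> level_counts K (level w k) N ->
  allocates K m (fun l => nth 0%N (alloc l)) N ->
  achieves (n.+1 * (3 * m.+1 + 5))
    (fun A : assignment m n => forall l u, (l < m.+1)%N -> (u < K)%N ->
       counts (level w k) A l u = nth 0%N (alloc l) u)
    (distribute m lev alloc).
Proof.
move=> levE [_ NE] alloc_ok.
pose T := ((nat -> seq nat) * ('I_n.+1 -> 'I_m.+1))%type.
pose pick (al : nat -> seq nat) (l : nat) :=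
  nth 0%N (iota 0 m.+1)
    (find (fun q => (0 < nth 0%N (al q) l)%N) (iota 0 m.+1)).
pose take (al : nat -> seq nat) (q l : nat) := fun q' =>
  if q' == q then set_nth 0%N (al q) l (nth 0%N (al q) l).-1 else al q'.
pose body (st : T) i :=
  bind (read 1 lev i) (fun l =>
  bind (loop (fun q0 q => Defs.charge 2 (if (0 < nth 0%N (st.1 q) l)%N then q
                                         else q0))
             (rev (iota 0 m.+1)) 0%N) (fun q =>
  bind (write 2 st.1 q (set_nth 0%N (st.1 q) l (nth 0%N (st.1 q) l).-1))
    (fun al =>
  bind (write 1 st.2 i (inord q : 'I_m.+1)) (fun A =>
  Defs.charge 0 (al, A))))).
have bodyP (st : T) i : achieves (3 * m.+1 + 4)
    (eq (take st.1 (pick st.1 (lev i)) (lev i),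
         fun i' => if i' == i then inord (pick st.1 (lev i)) else st.2 i'))
    (body st i).
  apply: (achieves_bind (a := 1) (P := eq (lev i)));
    [exact: achieves_charge|lia|].
  move=> _ <-; apply: (achieves_bind (achieves_search 2
    (fun q => (0 < nth 0%N (st.1 q) (lev i))%N) (iota 0 m.+1) 0%N)).
    by rewrite size_iota; lia.
  move=> _ <-; rewrite size_iota.
  apply: (achieves_bind (a := 2)
    (P := eq (take st.1 (pick st.1 (lev i)) (lev i)))).
  - exact: achieves_charge.
  - by lia.
  move=> _ <-; apply: (achieves_bind (a := 1) (P := eq (fun i' =>
    if i' == i then inord (pick st.1 (lev i)) else st.2 i'))).
  - exact: achieves_charge.
  - by lia.
  by move=> _ <-; exact: achieves_charge.
have lev_lt i : (lev i < K)%N by rewrite levE ltnS level_le.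
(* Here [s] lists the tasks still to be placed; [uniq] ensures that no placed task is moved
   later. *)
have loopP (s : seq 'I_n.+1) : forall st : T, uniq s ->
    (forall u, (u < K)%N -> (\sum_(q < m.+1) nth 0 (st.1 q) u)%N =
                            count (fun i => lev i == u) s) ->
    achieves (size s * (3 * m.+1 + 5)) (fun st' : T =>
      (forall i, i \notin s -> st'.2 i = st.2 i) /\
      forall q u, (q < m.+1)%N -> (u < K)%N ->
        count (fun i => (st'.2 i == q :> nat) && (lev i == u)) s =
        nth 0%N (st.1 q) u)
    (loop body s st).
  elim: s => [|i s IHs] st /=.
    move=> _ sum0; apply: achieves_charge => //; split=> // q u qm uK.
    have /eqP := sum0 u uK; rewrite sum_nat_eq0 => /forallP/(_ (Ordinal qm)).
    by move=> /eqP.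
  move=> /andP[is_ us] sumE; rewrite mulSn.
  rewrite (_ : 3 * m.+1 + 5 = (3 * m.+1 + 4).+1)%N; last by lia.
  apply: achieves_loop_cons (bodyP st i) _ => _ <-.
  set l := lev i; set q := pick st.1 l.
  have hasq : has (fun q => (0 < nth 0%N (st.1 q) l)%N) (iota 0 m.+1).
    apply: contraT => /hasPn none.
    have := sumE l (lev_lt i); rewrite eqxx big1// => q' _.
    have := none q'; rewrite mem_iota add0n => /(_ (ltn_ord q')).
    by rewrite -eqn0Ngt => /eqP.
  have q_gt0 : (0 < nth 0%N (st.1 q) l)%N by exact: nth_find hasq.
  have qm : (q < m.+1)%N.
    have : q \in iota 0 m.+1 by rewrite mem_nth// -has_find.
    by rewrite mem_iota.
  (* Placing task [i] uses up exactly one place, on [q] at level [l]. *)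
  have takeE q' u : nth 0%N (st.1 q') u =
      ((q == q') && (l == u) + nth 0%N (take st.1 q l q') u)%N.
    rewrite /take [q == q']eq_sym; have [->|//] := eqVneq q' q.
    rewrite nth_set_nth/= [l == u]eq_sym; have [->|//] := eqVneq u l.
    by rewrite add1n prednK.
  rewrite (_ : (3 * m.+1 + 4).+1 = 3 * m.+1 + 5)%N; last by lia.
  apply: (achieves_weaken _ (leqnn _) (IHs _ us _)) => /=; last first.
    move=> u uK; have := sumE u uK.
    under eq_bigr do rewrite takeE.
    rewrite big_split/= (bigD1 (Ordinal qm))//= eqxx/= big1 => [|q' ].
      by rewrite addn0 => /addnI.
    by rewrite -val_eqE/= eq_sym => /negPf ->.
  move=> st' [keep cnt]; split=> [i'|q' u q'm uK].
    by rewrite inE negb_or => /andP[/negPf i'i /keep ->]; rewrite i'i.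
  by rewrite takeE cnt// keep// eqxx inordK.
have [] := loopP (enum 'I_n.+1) (alloc, fun=> ord0) (enum_uniq _) _.
  move=> u uK; rewrite [LHS]alloc_ok// NE.
  by apply: eq_count => i; rewrite levE.
rewrite size_enum_ord => -[_ cnt] stepsP.
apply: (achieves_bind (P := fun st : T => forall q u, (q < m.+1)%N ->
  (u < K)%N -> count (fun i => (st.2 i == q :> nat) && (lev i == u))
    (enum 'I_n.+1) = nth 0%N (alloc q) u) (conj cnt stepsP)) => // st cnt_st.
apply: achieves_charge => // l u lm uK; rewrite -[RHS]cnt_st//.
by apply: eq_count => i; rewrite ffunE levE.
Qed.

(** One summand per phase. A row has at most [n.+2 ^ K] entries, as each of the [K] counts lies
    between 0 and [n.+1]. *)
Definition scheme_bound : nat :=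
  6 * K + (n.+1 * (4 * K + 3) + (fill_bound m K M (n.+2 ^ K) +
  (m.+1 * (3 * K + 2) + n.+1 * (3 * m.+1 + 5))))%N.

(** The assignment returned has the counts of the traceback, hence the cost stored in the table, and
    this is at most the cost of the counts of any other assignment. *)
Lemma scheme_spec :
  achieves scheme_bound (optimal d (rounded w k)) (scheme cands k d w).
Proof.
apply: (achieves_bind grid_values_spec); first exact: leq_addr.
move=> V VP; rewrite addKn.
apply: (achieves_bind (levels_spec VP)); first exact: leq_addr.
case=> lev N [/= levE NP]; rewrite addKn; have [NK NE] := NP.
have N_le u : (nth 0%N N u <= n.+1)%N.
  by rewrite NE (leq_trans (count_size _ _))// size_enum_ord.
have cands_size' j : j \in all_vectors N -> (size (cands j) <= M)%N.
  move=> /all_vectorsP[jN le_j]; apply: cands_size; first by rewrite jN.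
  by move=> u; exact: leq_trans (N_le u).
have bound_le : (fill_bound m K M (size (all_vectors N)) <=
                 fill_bound m K M (n.+2 ^ K))%N.
  have := size_all_vectors N_le; rewrite NK => le_A.
  by rewrite leq_add ?leq_mul// ltnS leq_mul.
have fillP : achieves (fill_bound m K M (n.+2 ^ K)) (filled K cands d V N m)
    (fill_table cands d V N).
  by apply: (achieves_weaken _ bound_le
    (fill_table_spec d V NK cands_valid cands_size')).
apply: (achieves_bind fillP); first exact: leq_addr.
move=> tab fill; rewrite addKn.
apply: (achieves_bind (traceback_spec NK cands_valid fill)).
  exact: leq_addr.
move=> al [al_ok al_cost]; rewrite addKn.
apply: (achieves_weaken _ (leqnn _) (distribute_spec levE NP al_ok)) => A AE B.
have VE C : cost d (rounded w k) C = cost d (fun i => V (level w k i)) C.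
  apply: eq_bigr => i _; congr (_ * _); apply: eq_bigr => i' _.
  by rewrite VP.
have lev_lt i : (level w k i < K)%N by rewrite ltnS.
rewrite !VE !(cost_counts d V lev_lt).
apply: le_trans (opt_table_le cands_valid (cands_sufficient VP) NK
  (counts_allocates B NP)).
rewrite -al_cost le_eqVlt; apply/orP; left; apply/eqP.
apply: eq_bigr => l _; apply: eq_resource_cost => u uK.
by rewrite AE.
Qed.

End SchemeSpec.

(** * Run time *)

(** Passes from the base [n.+2] of the table size to the number [n.+1] of tasks, for a factor
    depending on [K] only. *)
Lemma expnSS_le n K : (n.+2 ^ K <= 2 ^ K * n.+1 ^ K)%N.
Proof. by rewrite -expnMn; case: K => // K; rewrite leq_exp2r//; lia. Qed.

Definition scheme_factor (K : nat) : nat :=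
  (2 ^ K * (20 * K + 15) + 13 * K + 14)%N.

Lemma scheme_bound_le m n k M :
  (scheme_bound m n k M <=
   scheme_factor k.+1 * (m.+1 * (n.+1 ^ k.+1 * M.+1)))%N.
Proof.
rewrite /scheme_bound /fill_bound /scheme_factor.
have le_A := expnSS_le n k.+1.
have X_le : (n.+1 <= n.+1 ^ k.+1)%N by rewrite -{1}[n.+1]expn1 leq_pexp2l.
set K := k.+1 in le_A X_le *; set A := (n.+2 ^ K)%N in le_A *.
set E := (2 ^ K)%N in le_A *; set Z := (n.+1 ^ K)%N in le_A X_le *.
(* Each phase is bounded by a multiple of the common unit [W]; [scheme_factor] is the sum of the
   multipliers. *)
set W := (m.+1 * (Z * M.+1))%N.
have ZW : (m.+1 * Z <= W)%N by rewrite leq_mul2l leq_pmulr ?orbT.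
have XYW : (n.+1 * m.+1 <= W)%N.
  by apply: leq_trans ZW; rewrite mulnC leq_mul2l X_le orbT.
have XW : (n.+1 <= W)%N by apply: leq_trans XYW; rewrite leq_pmulr.
have YW : (m.+1 <= W)%N by apply: leq_trans XYW; rewrite leq_pmull.
have W1 : (1 <= W)%N by apply: leq_trans YW.
have AW : (A * (8 * K + 5) <= E * (8 * K + 5) * W)%N.
  rewrite mulnAC leq_mul// (leq_trans le_A)// leq_mul// (leq_trans _ ZW)//.
  by rewrite leq_pmull.
have AMW : (m * (A * (3 * K + M * (9 * K + 7) + 3)).+1 <=
    (E * (12 * K + 10) + 1) * W)%N.
  rewrite mulnS mulnDl mul1n addnC leq_add//; last by apply: leq_trans YW.
  apply: (@leq_trans (m.+1 * (E * Z * (M.+1 * (12 * K + 10))))).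
    by rewrite leq_mul// leq_mul//; nia.
  by rewrite /W; apply/eq_leq; ring.
have t1 : (6 * K <= 6 * K * W)%N by rewrite leq_pmulr.
have t2 : (n.+1 * (4 * K + 3) <= (4 * K + 3) * W)%N.
  by rewrite mulnC leq_mul2l XW orbT.
have t3 : (m.+1 * (3 * K + 2) <= (3 * K + 2) * W)%N.
  by rewrite mulnC leq_mul2l YW orbT.
have t4 : (n.+1 * (3 * m.+1 + 5) <= 8 * W)%N by lia.
have -> : ((E * (20 * K + 15) + 13 * K + 14) * W =
  6 * K * W + ((4 * K + 3) * W + ((E * (8 * K + 5) * W +
   (E * (12 * K + 10) + 1) * W) + ((3 * K + 2) * W + 8 * W))))%N by ring.
by rewrite !leq_add.
Qed.

Lemma full_bound_le m n k : (scheme_bound m n k (n.+2 ^ k.+1) <=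
  scheme_factor k.+1 * (2 ^ k.+1).+1 * (m.+1 * n.+1 ^ (2 * k.+1)))%N.
Proof.
apply: leq_trans (scheme_bound_le _ _ _ _) _.
rewrite -mulnA leq_mul// [leqRHS]mulnCA leq_mul//.
rewrite mul2n -addnn expnD [leqRHS]mulnCA leq_mul//.
by rewrite mulSn -add1n leq_add ?expn_gt0// expnSS_le.
Qed.

(** The number of candidates is quadratic in [n.+2], so the exponent is [k.+1 + 2], which is at most
    [2 * k] from [k = 3] on. *)
Lemma block_bound_le m n k : (3 <= k)%N ->
  (scheme_bound m n k (k.+1 ^ 2 * n.+2 ^ 2) <=
   scheme_factor k.+1 * (4 * k.+1 ^ 2).+1 * (m.+1 * n.+1 ^ (2 * k)))%N.
Proof.
move=> k3; apply: leq_trans (scheme_bound_le _ _ _ _) _.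
rewrite -mulnA leq_mul// [leqRHS]mulnCA leq_mul//.
apply: (@leq_trans ((4 * k.+1 ^ 2).+1 * n.+1 ^ (k.+1 + 2))); last first.
  by rewrite leq_mul// leq_pexp2l//; lia.
rewrite expnD [leqRHS]mulnCA leq_mul// mulSn -add1n leq_add ?expn_gt0//.
rewrite mulnAC mulnC leq_mul//; exact: (expnSS_le n 2).
Qed.

(** * Accuracy of the two schemes and choice of k *)

Section Solution.
Variables (R : realType) (m n k : nat).
Variables (d : 'I_m.+1 -> R) (w : 'I_n.+1 -> R).
Hypothesis inst : problem_instance d w.
Hypothesis k_gt0 : (0 < k)%N.

Let d_gt0 : forall l, 0 < d l. Proof. by case: inst. Qed.
Let w_ge1 : forall i, 1 <= w i. Proof. by case: inst. Qed.
Let w_sorted : forall i i' : 'I_n.+1, (i <= i')%N -> w i' <= w i.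
Proof. by case: inst. Qed.

Lemma full_scheme_spec :
  achieves (scheme_bound m n k (n.+2 ^ k.+1)) (optimal d (rounded w k))
    (full_scheme k d w).
Proof.
apply: scheme_spec.
- by move=> j v _ /all_vectorsP.
- by move=> j jK /size_all_vectors; rewrite jK.
- exact: level_le.
- by move=> V _; exact: all_vectors_sufficient.
Qed.

Lemma block_scheme_spec :
  achieves (scheme_bound m n k (k.+1 ^ 2 * n.+2 ^ 2)) (optimal d (rounded w k))
    (block_scheme k d w).
Proof.
apply: scheme_spec.
- by move=> j v _; exact: block_vectors_dominated.
- by move=> j jK /size_block_vectors; rewrite jK.
- exact: level_le.
- move=> V VP; apply: block_vectors_sufficient => s t st tk.
  by rewrite !VP; [exact: grid_homo|lia|lia].
Qed.

(** Rounding up only raises costs, so the cost under [w] is at most the cost under the rounded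
    weights, to which [optimal_approx] applies. *)
Lemma achieves_solves (eps : R) c (alg : timed (assignment m n)) :
  weight_ratio w `^ k%:R^-1 <= 1 + eps ->
  achieves c (optimal d (rounded w k)) alg -> solves alg eps k d w.
Proof.
move=> ratio_le [opt _]; split=> // A _.
apply: le_trans (cost_le d_gt0 _ (le_rounded w_ge1 w_sorted k_gt0)) _.
by apply: optimal_approx opt => // i; exact: rounded_le.
Qed.

End Solution.

(** Applying [ln (1 + y) <= y] to the inverse of [1 + eps] gives [eps / (1 + eps) <= ln (1 + eps)],
    and [1 + eps <= 2]. *)
Lemma half_le_ln1D (R : realType) (eps : R) : 0 < eps -> eps <= 1 ->
  eps / 2 <= ln (1 + eps).
Proof.
move=> eps_gt0 eps_le1; have D_gt0 : 0 < 1 + eps by lra.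
have : ln (1 + - (eps / (1 + eps))) <= - (eps / (1 + eps)).
  by apply: le_ln1Dx; rewrite ltrN2 ltr_pdivrMr//; lra.
have -> : 1 + - (eps / (1 + eps)) = (1 + eps)^-1 by field; lra.
rewrite lnV ?posrE// lerN2; apply: le_trans.
by rewrite ler_pM2l// lef_pV2 ?posrE//; lra.
Qed.

(** In logarithms: [ln rho <= ln alpha <= k * eps / 2 <= k * ln (1 + eps)]. *)
Lemma ratio_root_le (R : realType) (alpha eps rho : R) (k : nat) :
  0 < eps -> eps <= 1 -> 0 < rho -> rho <= alpha ->
  2 * (eps^-1 * ln alpha) <= k%:R -> (0 < k)%N ->
  rho `^ k%:R^-1 <= 1 + eps.
Proof.
move=> eps_gt0 eps_le1 rho_gt0 rho_le le_k k_gt0.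
have alpha_gt0 : 0 < alpha := lt_le_trans rho_gt0 rho_le.
rewrite -ler_ln ?posrE ?powR_gt0//; last by lra.
rewrite ln_powR mulrC ler_pdivrMr ?ltr0n//.
apply: le_trans (_ : eps / 2 * k%:R <= _); last first.
  by rewrite ler_pM2r ?ltr0n// half_le_ln1D.
apply: le_trans (_ : ln alpha <= _); first by rewrite ler_ln ?posrE.
have -> : ln alpha = eps / 2 * (2 * (eps^-1 * ln alpha)) by field; lra.
by rewrite ler_pM2l// divr_gt0.
Qed.

(** The order of quantifiers expresses the O-bounds: [c] is absolute, while [k] and [K] depend on
    [alpha] and [eps] but not on the instance. *)
Theorem mainTheorem12 (R : realType) :
  exists c : R, 0 < c /\
  forall alpha eps : R, 1 <= alpha -> 0 < eps -> eps <= 1 ->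
  (forall (m n k : nat) (d : 'I_m.+1 -> R) (w : 'I_n.+1 -> R),
     problem_instance d w -> weight_ratio w <= alpha ->
     (0 < k)%N -> weight_ratio w `^ (k%:R^-1) <= 1 + eps ->
     [/\ forall i, (level w k i <= k)%N /\ w i <= rounded w k i,
         (size (undup (codom (rounded w k))) <= k.+1)%N,
         forall A' A : assignment m n,
           optimal d (rounded w k) A' -> optimal d w A ->
           cost d (rounded w k) A' <= (1 + eps) * cost d w A,
         solves (full_scheme k d w) eps k d w
       & solves (block_scheme k d w) eps k d w])
  /\
  (exists k : nat,
     [/\ (0 < k)%N,
         k%:R <= c * (1 + eps^-1 * ln alpha),
         forall (m n : nat) (d : 'I_m.+1 -> R) (w : 'I_n.+1 -> R),
           problem_instance d w -> weight_ratio w <= alpha ->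
           weight_ratio w `^ (k%:R^-1) <= 1 + eps
       & exists K : nat,
         forall (m n : nat) (d : 'I_m.+1 -> R) (w : 'I_n.+1 -> R),
           problem_instance d w -> weight_ratio w <= alpha ->
           (steps (full_scheme k d w) <= K * (m.+1 * n.+1 ^ (2 * k.+1)))%N /\
           (steps (block_scheme k d w) <= K * (m.+1 * n.+1 ^ (2 * k)))%N]).
Proof.
(* The [k] chosen below is at most [2 * x + 3] with [x = eps^-1 * ln alpha >= 0], hence at most
   [3 * (1 + x)]. *)
exists 3; split=> // alpha eps alpha_ge1 eps_gt0 eps_le1; split.
  move=> m n k d w inst _ k_gt0 ratio_le; have [d_gt0 _ w_ge1 w_sorted] := inst.
  split.
  - by move=> i; split; [exact: level_le|exact: le_rounded].
  - exact: size_undup_rounded.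
  - move=> A' A A'_opt _; apply: optimal_approx A'_opt => // i.
    exact: rounded_le.
  - exact: achieves_solves (full_scheme_spec inst k_gt0).
  - exact: achieves_solves (block_scheme_spec inst k_gt0).
set x := eps^-1 * ln alpha.
have x_ge0 : 0 <= x by rewrite mulr_ge0 ?ln_ge0// invr_ge0 ltW.
have x2_ge0 : 0 <= 2 * x by rewrite mulr_ge0.
(* The bound O(m n^(k+3)) on the run time with block vectors is O(m n^(2k))
   only from k = 3 on. *)
pose k := (Num.truncn (2 * x) + 3)%N.
have k_gt0 : (0 < k)%N by rewrite /k addn3.
have /andP[t_le t_gt] := truncn_itv x2_ge0.
have le_k : 2 * x <= k%:R by rewrite /k natrD; move: t_gt; rewrite -natr1; lra.
exists k; split=> //.
- by rewrite /k natrD; lra.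
- move=> m n d w [_ _ w_ge1 w_sorted] ratio_le.
  apply: (@ratio_root_le _ alpha) => //.
  exact: lt_le_trans (weight_ratio_ge1 w_ge1 w_sorted).
(* The sum of the constants for the two candidate families serves both bounds. *)
exists (scheme_factor k.+1 * ((2 ^ k.+1).+1 + (4 * k.+1 ^ 2).+1))%N.
move=> m n d w inst _; split.
- have [_ /leq_trans] := full_scheme_spec inst k_gt0; apply.
  by rewrite (leq_trans (full_bound_le _ _ _))// !leq_mul// leq_addr.
- have [_ /leq_trans] := block_scheme_spec inst k_gt0; apply.
  rewrite (leq_trans (block_bound_le _ _ _))// ?leq_addl//.
  by rewrite !leq_mul// leq_addl.
Qed.
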